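(* Let $b\in(0,3]$. Given any $c_0\in\mathbb{R}\setminus\{0\}$ and any $\alpha,\beta\in\mathbb{R}$ with $\alpha<\beta$, there exists $u_0\in C_0^\infty(\mathbb{R})$ with $$u_0(x)=c_0\quad\text{for all } x\in[\alpha,\beta],$$ such that the corresponding solution $u=u(x,t)$, defined on a time interval $[-T,T]$ with $T>0$, of the initial value problem on $\mathbb{R}$ $$\partial_t u+u\,\partial_x u+\partial_x(1-\partial_x^2)^{-1}\Big(\frac{b}{2}u^2+\frac{3-b}{2}(\partial_x u)^2\Big)=0,\qquad u(x,0)=u_0(x),$$ satisfies $$\partial_t u(x,0)=0\quad\text{for all } x\in[\alpha,\beta].$$ In particular, for every $t\in(-T,T)$ the function $u(\cdot,t)$ is not identically equal to $c_0$.
   Context: $C_0^\infty(\mathbb{R})$ denotes the real-valued smooth functions on $\mathbb{R}$ with compact support. $H^s(\mathbb{R})=(1-\partial_x^2)^{-s/2}L^2(\mathbb{R})$ is the Sobolev space, and $W^{1,\infty}(\mathbb{R})$ is the space of (bounded) Lipschitz functions. The operator $(1-\partial_x^2)^{-1}$ is convolution on $\mathbb{R}$ with $\frac12 e^{-|x|}$, so that $$\partial_x(1-\partial_x^2)^{-1}g(x)=-\frac12\int_{-\infty}^{\infty}\mathrm{sgn}(x-y)e^{-|x-y|}g(y)\,dy.$$ The equation in the claim is called the $b$-family of equations ($b=2$ is the Camassa-Holm equation, $b=3$ the Degasperis-Procesi equation). Corresponding solution: the following well-posedness facts are known and fix the meaning of ''the corresponding solution''. (i) For $s>3/2$ and any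 $u_0\in H^s(\mathbb{R})$ there exist $T=T(\|u_0\|_{H^s})>0$ and a unique solution $u\in C([-T,T]:H^s(\mathbb{R}))\cap C^1((-T,T):H^{s-1}(\mathbb{R}))$ of the initial value problem. (ii) For any $u_0\in X:=H^1(\mathbb{R})\cap W^{1,\infty}(\mathbb{R})$ there exist $T=T(\|u_0\|_X)>0$ and a unique solution $u\in C([-T,T]:H^1(\mathbb{R}))\cap C^1((-T,T):L^2(\mathbb{R}))\cap L^\infty([-T,T]:W^{1,\infty}(\mathbb{R}))$. Data $u_0\in C_0^\infty(\mathbb{R})$ lie in all these spaces, and the corresponding solution is the one in these classes (for any $s>3/2$), on its interval $[-T,T]$. The pointwise value $\partial_t u(x,0)$ refers to the continuous representative of $\partial_t u(\cdot,0)$. *)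

(* Defs.v *)
From HB Require Import structures.
From mathcomp Require Import all_boot all_order all_algebra.
From mathcomp Require Import all_classical all_reals all_analysis.

Set Implicit Arguments.
Unset Strict Implicit.
Unset Printing Implicit Defensive.

Import Order.TTheory GRing.Theory Num.Theory.
Import numFieldNormedType.Exports.

Local Open Scope classical_set_scope.
Local Open Scope ring_scope.

Local Notation mu := lebesgue_measure.

Definition Cinfty0 (R : realType) (f : R -> R) : Prop :=
  (forall (n : nat) (x : R), derivable (derive1n n f) x 1) /\
  compact (closure [set x | f x != 0]).

(* Functions of the space variable are genuine functions R -> R; elements of
   L^2 and H^s are represented by any function in the a.e. class. *)

Definition L2 (R : realType) : set (R -> R) :=
  [set f | f \in Lfun mu 2%:E].

Definition L2norm (R : realType) (f : R -> R) : \bar R :=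
  ('N[mu]_2%:E [EFin \o f])%E.

(* Real and imaginary parts of
   (2 pi)^(-1/2) \int_(-n)^n f(x) e^(- i x xi) dx. *)
Definition fourier_re (R : realType) (f : R -> R) (n : nat) (xi : R) : R :=
  (Num.sqrt (2 * pi))^-1 *
  \int[mu]_(x in `[- n%:R, n%:R]) (f x * cos (x * xi)).

Definition fourier_im (R : realType) (f : R -> R) (n : nat) (xi : R) : R :=
  - (Num.sqrt (2 * pi))^-1 *
  \int[mu]_(x in `[- n%:R, n%:R]) (f x * sin (x * xi)).

(* p + i q is the L^2 (Plancherel) Fourier transform of the real function f. *)
Definition is_fourier (R : realType) (f p q : R -> R) : Prop :=
  [/\ L2 f, L2 p, L2 q,
      L2norm (fourier_re f n \- p) @[n --> \oo] --> 0%E &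
      L2norm (fourier_im f n \- q) @[n --> \oo] --> 0%E].

(* (1 + xi^2)^(s/2) |p + i q|: the modulus of the Fourier transform of
   (1 - d_x^2)^(s/2) f when p + i q is that of f. *)
Definition bessel_weight (R : realType) (s : R) (p q : R -> R) (xi : R) : R :=
  (1 + xi ^+ 2) `^ (s / 2) * Num.sqrt (p xi ^+ 2 + q xi ^+ 2).

(* H^s = (1 - d_x^2)^(-s/2) L^2; only used for s >= 0, where H^s is a subspace
   of L^2. *)
Definition Hs (R : realType) (s : R) : set (R -> R) :=
  [set f | exists p q, is_fourier f p q /\ L2 (bessel_weight s p q)].

(* The Fourier transform is unique up to a.e. equality, so the infimum is over
   at most one value. *)
Definition Hsnorm (R : realType) (s : R) (f : R -> R) : \bar R :=
  ereal_inf [set e | exists p q,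
    is_fourier f p q /\ e = L2norm (bessel_weight s p q)].

(* Curves t |-> u t with values in a function space E with norm N. *)

Definition C0_in_time (R : realType) (E : set (R -> R))
    (N : (R -> R) -> \bar R) (I : set R) (u : R -> R -> R) : Prop :=
  forall t0, I t0 ->
    E (u t0) /\ N (u t \- u t0) @[t --> within I (nbhs t0)] --> 0%E.

(* u is in C^1(I : E), for I open, and its derivative in time is u'. *)
Definition C1_in_time (R : realType) (E : set (R -> R))
    (N : (R -> R) -> \bar R) (I : set R) (u u' : R -> R -> R) : Prop :=
  [/\ forall t, I t -> E (u t),
      C0_in_time E N I u' &
      forall t0, I t0 ->
        N (fun x => h^-1 * (u (t0 + h) x - u t0 x) - u' t0 x)
          @[h --> 0^'] --> 0%E].

(* u is essentially bounded on I with values in W^{1,oo}, the space of bounded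
   Lipschitz functions. *)
Definition Linfty_W1infty (R : realType) (I : set R) (u : R -> R -> R) : Prop :=
  exists M : R, {ae mu, forall t, I t ->
    (forall x, `|u t x| <= M) /\
    (forall x y, `|u t x - u t y| <= M * `|x - y|)}.

(* d_x (1 - d_x^2)^(-1) g, where (1 - d_x^2)^(-1) is the convolution with
   e^(-|x|) / 2. *)
Definition dx_inv_helmholtz (R : realType) (g : R -> R) (x : R) : R :=
  - 2^-1 * \int[mu]_y (Num.sg (x - y) * expR (- `|x - y|) * g y).

(* The b-family equation at one time, as an identity between classes of
   functions of x; v is the profile u(.,t) and v' is d_t u(.,t).
   The spatial derivative is the pointwise one: v is the continuous
   representative of an H^1 function, hence absolutely continuous, so it is
   differentiable a.e. with derivative equal to its weak derivative. *)
Definition b_family (R : realType) (b : R) (v v' : R -> R) : Prop :=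
  {ae mu, forall x,
    v' x + v x * derive1 v x +
    dx_inv_helmholtz
      (fun y => b / 2 * v y ^+ 2 + (3 - b) / 2 * derive1 v y ^+ 2) x = 0}.

(* u t is the continuous representative of u(.,t), and ut t represents
   d_t u(.,t). *)
Definition solves_ivp (R : realType) (b : R) (u0 : R -> R) (T : R)
    (u ut : R -> R -> R) : Prop :=
  [/\ forall t, t \in `[- T, T] -> continuous (u t),
      u 0 = u0 &
      forall t, t \in `]- T, T[ -> b_family b (u t) (ut t)].

Definition solution_Hs (R : realType) (s b : R) (u0 : R -> R) (T : R)
    (u ut : R -> R -> R) : Prop :=
  [/\ C0_in_time (Hs s) (Hsnorm s) `[- T, T] u,
      C1_in_time (Hs (s - 1)) (Hsnorm (s - 1)) `]- T, T[ u ut &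
      solves_ivp b u0 T u ut].

Definition solution_X (R : realType) (b : R) (u0 : R -> R) (T : R)
    (u ut : R -> R -> R) : Prop :=
  [/\ C0_in_time (Hs 1) (Hsnorm 1) `[- T, T] u,
      C1_in_time (@L2 R) (@L2norm R) `]- T, T[ u ut,
      Linfty_W1infty `[- T, T] u &
      solves_ivp b u0 T u ut].

(* u is the solution on [-T, T] with initial datum u0, in either of the two
   classes where the problem is well posed, and ut is its time derivative. *)
Definition corresponding_solution (R : realType) (b : R) (u0 : R -> R) (T : R)
    (u ut : R -> R -> R) : Prop :=
  solution_X b u0 T u ut \/
  exists s : R, 3 / 2 < s /\ solution_Hs s b u0 T u ut.

(* Main.v *)
Require Import Defs.
From mathcomp Require Import all_boot all_order all_algebra.
From mathcomp Require Import all_classical all_reals all_analysis.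
From mathcomp Require Import ring lra.
Import Order.TTheory GRing.Theory Num.Theory.
Import numFieldNormedType.Exports.
Local Open Scope classical_set_scope.
Local Open Scope ring_scope.

Set Implicit Arguments.
Unset Strict Implicit.
Unset Printing Implicit Defensive.

(** At time 0 the equation reads d_t u = - (u0 u0' + F), where
F = d_x (1 - d_x^2)^(-1) g and g = b/2 u0^2 + (3-b)/2 u0'^2 is the energy
density of the datum. On an interval where u0 = c0 the transport term vanishes,
so the datum has to be chosen in such a way that the nonlocal term F vanishes
there too. Splitting the kernel at x gives

  F x = - 1/2 (e^(-x) P x + e^x Q x),   P x = \int_(y < x) e^y g y,
                                        Q x = - \int_(y > x) e^(-y) g y

([dx_inv_helmholtz_primitive]). If u0 were equal to c0 everywhere, then
P x = b/2 c0^2 e^x and Q x = - b/2 c0^2 e^(-x), and the two terms would cancel.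
Hence it suffices to let u0 descend to 0 on the left of the interval without
changing the total weighted energy \int e^y g that the constant would have there,
and symmetrically on the right.

Such a descent exists ([balanced_left_profile]): cut the constant 1 off at a
distance L, and add s phi with a bump phi supported where the cut-off equals 1.
The defect of weighted energy is a quadratic polynomial in s,

  k e^(-L) + (b \int e^x phi) s + (\int e^x (energy of phi)) s^2,

whose linear coefficient is nonzero. The cost k e^(-L) of the cut-off becomes
small because of the exponential weight, so for L large there is a real root s.

The datum is c0 times the product of this profile, translated to the left end,
and of its mirror image, translated to the right end ([stationary_datum]). It
equals c0 on a slightly larger interval than required, which makes its
derivative vanish at the end points as well. The function - (u0 u0' + F) is
continuous because P and Q are, and it represents d_t u(.,0) because the
equation holds at time 0. Finally u(.,t) lies in L^2 in both solution classes,
while a nonzero constant does not ([L2_cst_eq0]). *)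

(** * Derivatives and smooth functions of one variable *)

Section calculus.
Context {R : realType}.
Implicit Types (f g : R -> R) (x a b c : R).

Lemma is_derive_fun_add f g x df dg :
  is_derive x 1 f df -> is_derive x 1 g dg ->
  is_derive x 1 (fun y => f y + g y) (df + dg).
Proof. exact: is_deriveD. Qed.

Lemma is_derive_fun_mul f g x df dg :
  is_derive x 1 f df -> is_derive x 1 g dg ->
  is_derive x 1 (fun y => f y * g y) (df * g x + f x * dg).
Proof.
move=> hf hg; apply: (is_derive_eq (is_deriveM hf hg)).
by rewrite /GRing.scale /= addrC (mulrC (g x)).
Qed.

Lemma is_derive_fun_scale f x c df :
  is_derive x 1 f df -> is_derive x 1 (fun y => c * f y) (c * df).
Proof. exact: is_deriveZ. Qed.

Lemma is_derive_fun_comp f g x df dg :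
  is_derive (g x) 1 f df -> is_derive x 1 g dg ->
  is_derive x 1 (fun y => f (g y)) (df * dg).
Proof. exact: is_derive1_comp. Qed.

Lemma is_derive_affine a b x : is_derive x 1 (fun y : R => a * y + b) a.
Proof.
have h := is_derive_fun_add (is_derive_fun_scale a (is_derive_id x 1))
  (is_derive_cst b x 1).
by apply: (is_derive_eq h); rewrite mulr1 addr0.
Qed.

Lemma is_derive_comp_affine f a b x df :
  is_derive (a * x + b) 1 f df ->
  is_derive x 1 (fun y => f (a * y + b)) (a * df).
Proof.
move=> hf; rewrite mulrC.
have ha := is_derive_affine a b x.
exact: (is_derive_fun_comp (g := fun y => a * y + b) hf ha).
Qed.

Lemma is_derive_fun_inv f x df : f x != 0 -> is_derive x 1 f df ->
  is_derive x 1 (fun y => (f y)^-1) (- 1 * df * ((f x)^-1 * (f x)^-1)).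
Proof.
move=> fx0 hf; have dv := @ex_derive _ _ _ _ _ _ _ hf.
apply: DeriveDef; first exact: derivableV.
by rewrite deriveV // derive_val /GRing.scale /= -exprVn; ring.
Qed.

Lemma derive1_val f x df : is_derive x 1 f df -> derive1 f x = df.
Proof. by move=> h; rewrite derive1E derive_val. Qed.

Lemma is_derive_derive1 f x : derivable f x 1 -> is_derive x 1 f (derive1 f x).
Proof. by move=> h; rewrite derive1E; exact: derivableP. Qed.

Lemma derivable_cts f : (forall x, derivable f x 1) -> continuous f.
Proof.
by move=> df x; apply: differentiable_continuous; apply/derivable1_diffP.
Qed.

Lemma is_derive_cts {f df} : (forall x, is_derive x 1 f (df x)) -> continuous f.
Proof.
move=> h; apply: derivable_cts => x.
exact: (@ex_derive _ _ _ _ _ _ _ (h x)).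
Qed.

Lemma derive1_locally f g x : (\near x, f x = g x) -> derive1 f x = derive1 g x.
Proof. by move=> h; rewrite !derive1E; exact: near_eq_derive. Qed.

Lemma derive1_locally_cst f c x : (\near x, f x = c) -> derive1 f x = 0.
Proof.
move=> h; rewrite (@derive1_locally f (cst c)) //.
exact: derive1_cst.
Qed.

(** Peeling the first derivative off, rather than the last one as [derive1n]
does, is what lets the closure properties below go by induction: the derivative
of a product, an inverse or a composite is an expression in functions that are
one step less regular. *)
Fixpoint Cn (n : nat) f : Prop :=
  if n is m.+1 then (forall x, derivable f x 1) /\ Cn m (derive1 f) else True.

Definition smooth f := forall n, Cn n f.

Lemma smooth_derivable f : smooth f -> forall x, derivable f x 1.
Proof. by move=> /(_ 1%N) []. Qed.

Lemma smooth_derive1 f : smooth f -> smooth (derive1 f).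
Proof. by move=> h n; case: (h n.+1). Qed.

Lemma smooth_derive1n f : smooth f -> forall n x, derivable (derive1n n f) x 1.
Proof.
move=> hf n; rewrite /derive1n; elim: n f hf => [|n IH] f hf.
  exact: smooth_derivable.
by rewrite iterSr; apply: IH; exact: smooth_derive1.
Qed.

Lemma CnW n f : Cn n.+1 f -> Cn n f.
Proof.
elim: n f => [//|n IH] f [df h]; split => //.
by apply: IH.
Qed.

Lemma Cn_cst n c : Cn n (cst c).
Proof.
elim: n c => [//|n IH] c; split; first by move=> x; exact: derivable_cst.
suff -> : derive1 (cst c : R -> R) = cst 0 by [].
by apply/funext => x; exact: derive1_cst.
Qed.

Lemma Cn_of_derive n f df :
  (forall x, is_derive x 1 f (df x)) -> Cn n df -> Cn n.+1 f.
Proof.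
move=> h hdf; split; first by move=> x; exact: (@ex_derive _ _ _ _ _ _ _ (h x)).
suff -> : derive1 f = df by [].
by apply/funext => x; exact: derive1_val.
Qed.

Lemma CnD n f g : Cn n f -> Cn n g -> Cn n (fun x => f x + g x).
Proof.
elim: n f g => [//|n IH] f g [df hf] [dg hg].
have dfg x : is_derive x 1 (fun x => f x + g x) (derive1 f x + derive1 g x).
  by apply: is_derive_fun_add; exact: is_derive_derive1.
by apply: (Cn_of_derive dfg); exact: IH.
Qed.

Lemma CnM n f g : Cn n f -> Cn n g -> Cn n (fun x => f x * g x).
Proof.
elim: n f g => [//|n IH] f g hf hg.
have [[df hf'] [dg hg']] := (hf, hg).
have dfg x :
    is_derive x 1 (fun x => f x * g x) (derive1 f x * g x + f x * derive1 g x).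
  by apply: is_derive_fun_mul; exact: is_derive_derive1.
by apply: (Cn_of_derive dfg); apply: CnD; apply: IH => //; exact: CnW.
Qed.

Lemma CnV n f : (forall x, f x != 0) -> Cn n f -> Cn n (fun x => (f x)^-1).
Proof.
move=> f0; elim: n => [//|n IH] hf.
have [df hf'] := hf.
have dV x : is_derive x 1 (fun x => (f x)^-1)
    (- 1 * derive1 f x * ((f x)^-1 * (f x)^-1)).
  by apply: is_derive_fun_inv => //; exact: is_derive_derive1.
apply: (Cn_of_derive dV).
have hV : Cn n (fun x => (f x)^-1) by apply: IH; exact: CnW.
by apply: CnM; apply: CnM => //; exact: Cn_cst.
Qed.

Lemma Cn_comp_affine n f a b : Cn n f -> Cn n (fun x => f (a * x + b)).
Proof.
elim: n f => [//|n IH] f [df hf].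
have dfa x : is_derive x 1 (fun x => f (a * x + b)) (a * derive1 f (a * x + b)).
  by apply: is_derive_comp_affine; exact: is_derive_derive1.
apply: (Cn_of_derive dfa).
by apply: CnM; [exact: Cn_cst|exact: IH].
Qed.

Lemma smooth_expR : smooth expR.
Proof. by elim=> [//|n IH]; apply: (Cn_of_derive (df := expR)). Qed.

End calculus.

(** * A smooth step function *)

Section smooth_step.
Context {R : realType}.
Implicit Types (p : {poly R}) (x t : R).

(** Each monomial is dominated by one term of the exponential series. *)
Lemma poly_le_expR p : exists C : R, forall t, 0 <= t -> `|p.[t]| <= C * expR t.
Proof.
exists (\sum_(i < size p) `|p`_i| * i`!%:R) => t t0.
rewrite horner_coef (le_trans (ler_norm_sum _ _ _)) // mulr_suml.
apply: ler_sum => i _; rewrite normrM -mulrA ler_wpM2l //.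
rewrite ger0_norm ?exprn_ge0 //.
case: (nat_of_ord i) => [|n].
  by rewrite expr0 fact0 mul1r -expR0 ler_expR.
rewrite mulrC -ler_pdivrMr ?ltr0n ?fact_gt0 //.
by apply: le_trans (expR_ge1Dxn n t0); rewrite lerDr.
Qed.

(** The classical flat function is the case p = 1; all polynomials p are taken
at once because the family is then closed under differentiation, which gives
smoothness by induction. *)
Definition flat p x : R := if 0 < x then p.[x^-1] * expR (- x^-1) else 0.

(** The estimate that yields the derivative 0 at the origin: p(t) t^2 is
dominated by e^t at t = 1/x. *)
Lemma flat_quadratic p : exists C : R, forall x, `|flat p x| <= C * x ^+ 2.
Proof.
have [C hC] := poly_le_expR (p * 'X^2).
have C0 : 0 <= C.
  by have := hC 0 (lexx _); rewrite expR0 mulr1; apply: le_trans.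
exists C => x; rewrite /flat; case: ifPn => x0; last first.
  by rewrite normr0 mulr_ge0 // sqr_ge0.
have hx : 0 <= x^-1 by rewrite invr_ge0 ltW.
have := hC _ hx.
rewrite hornerM hornerXn normrM (ger0_norm (exprn_ge0 2 hx)).
move=> h; rewrite normrM (ger0_norm (expR_ge0 _)) expRN ler_pdivrMr ?expR_gt0 //.
rewrite exprVn ler_pdivrMr ?exprn_gt0 // in h.
by rewrite (le_trans h) // -mulrA (mulrC (expR _)) mulrA.
Qed.

Lemma is_derive_quadratic (f : R -> R) (C : R) :
  (forall x, `|f x| <= C * x ^+ 2) -> is_derive (0 : R) 1 f 0.
Proof.
move=> hf.
have f0 : f 0 = 0.
  by apply/eqP; rewrite -normr_le0; have := hf 0; rewrite expr0n mulr0.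
have C0 : 0 <= C by have := hf 1; rewrite expr1n mulr1; apply: le_trans.
have cv : (fun h : R => h^-1 *: (f (h *: 1 + 0) - f 0)) @ 0^' --> (0 : R).
  apply/cvgr0Pnorm_le => e e0; near=> h.
  have h0 : h != 0 by near: h; exact: nbhs_dnbhs_neq.
  rewrite /GRing.scale /= mulr1 addr0 f0 subr0 normrM normfV.
  rewrite mulrC ler_pdivrMr ?normr_gt0 // (le_trans (hf h)) //.
  rewrite -real_normK ?num_real // expr2 mulrA ler_wpM2r //.
  have : `|h| <= e / (C + 1).
    near: h; apply: dnbhs0_le; rewrite divr_gt0 //; lra.
  rewrite ler_pdivlMr; last lra.
  move=> hh; rewrite (le_trans _ hh) // mulrC ler_wpM2l //; lra.
apply: DeriveDef; first by apply/cvg_ex; exists 0.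
exact: cvg_lim cv.
Unshelve. all: by end_near. Qed.

Lemma is_derive_flat p x : is_derive x 1 (flat p) (flat ('X^2 * (p - p^`())) x).
Proof.
case: (ltgtP x 0) => [x0|x0|->].
- have -> : flat ('X^2 * (p - p^`())) x = 0 by rewrite /flat ltNge ltW.
  apply: (near_eq_is_derive (f := cst 0)).
  near=> y; rewrite /flat ltNge ltW //=.
  near: y; exact: lt_nbhsl.
- have dV : is_derive x 1 (fun y : R => y^-1) (- (x^-1) ^+ 2).
    have := is_derive_fun_inv (f := id) (lt0r_neq0 x0) (is_derive_id x 1).
    by move=> h; apply: (is_derive_eq h); ring.
  have d1 := is_derive_fun_comp (g := fun y : R => y^-1) (is_derive_poly p x^-1) dV.
  have dN : is_derive x 1 (fun y : R => - y^-1) ((x^-1) ^+ 2).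
    by have := is_derive_fun_scale (- 1) dV; under eq_fun do rewrite mulN1r;
      move=> h; apply: (is_derive_eq h); ring.
  have d2 := is_derive_fun_comp (g := fun y : R => - y^-1) (is_derive_expR _) dN.
  have h : flat ('X^2 * (p - p^`())) x = p^`().[x^-1] * - (x^-1) ^+ 2 *
      expR (- x^-1) + p.[x^-1] * (expR (- x^-1) * (x^-1) ^+ 2).
    rewrite /flat x0 hornerM hornerXn hornerD hornerN; ring.
  rewrite h; apply: near_eq_is_derive (is_derive_fun_mul d1 d2).
  near=> y; rewrite /flat ifT //; near: y; exact: lt_nbhsr.
- have [C hC] := flat_quadratic p.
  rewrite [X in is_derive _ _ _ X](_ : _ = 0); last by rewrite /flat ltxx.
  exact: is_derive_quadratic hC.
Unshelve. all: by end_near. Qed.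

Lemma smooth_flat p : smooth (flat p).
Proof.
move=> n; elim: n p => [//|n IH] p.
exact: (Cn_of_derive (df := flat ('X^2 * (p - p^`()))) (is_derive_flat p) (IH _)).
Qed.

(** The bound -1/2, instead of 0, makes the step locally constant at 0, so that
its derivative vanishes on the whole half-line [x >= 0]. *)
Lemma smooth_step : exists chi : R -> R,
  [/\ smooth chi, forall x, x <= -1 -> chi x = 0 &
      forall x, - 2^-1 <= x -> chi x = 1].
Proof.
pose th := flat 1.
have th0 x : x <= 0 -> th x = 0 by rewrite /th /flat leNgt; case: ifP.
have thp x : 0 < x -> 0 < th x.
  by move=> x0; rewrite /th /flat x0 hornerC mul1r expR_gt0.
have thge x : 0 <= th x.
  by case: (leP x 0) => [/th0 ->//|/thp/ltW].
have den x : th (1 * x + 1) + th (- 1 * x + - 2^-1) != 0.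
  rewrite gt_eqF //; case: (ltP x (- 2^-1)) => hx.
    by rewrite ltr_wpDl // thp //; lra.
  by rewrite ltr_pwDl // thp //; lra.
exists (fun x => th (1 * x + 1) * (th (1 * x + 1) + th (- 1 * x + - 2^-1))^-1); split.
- move=> n; have h a b : Cn n (fun x => th (a * x + b)).
    by apply: Cn_comp_affine; exact: smooth_flat.
  by apply: CnM => //; apply: CnV => //; exact: CnD.
- by move=> x hx; rewrite (th0 (1 * x + 1)) ?mul0r //; lra.
- move=> x hx; rewrite (th0 (- 1 * x + - 2^-1)) ?addr0 ?divff // ?lt0r_neq0 ?thp //; lra.
Qed.

End smooth_step.

(** * Primitives of continuous functions *)

Section primitives.
Context {R : realType}.
Local Notation mu := (@lebesgue_measure R).
Implicit Types (f g h F P Q : R -> R) (x a b c : R).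

Lemma cts_integrable f a b : continuous f -> mu.-integrable `[a, b] (EFin \o f).
Proof.
move=> cf; apply: continuous_compact_integrable; first exact: segment_compact.
exact: continuous_subspaceT.
Qed.

(** Vanishing on the left of a turns the integral from a fixed base point into a
primitive on the whole line: the base point a - 1 keeps a itself in the interior
of the domain of the fundamental theorem. *)
Lemma primitive_from_left h a : continuous h -> (forall x, x <= a -> h x = 0) ->
  exists F, (forall x, is_derive x 1 F (h x)) /\ forall x, x <= a -> F x = 0.
Proof.
move=> ch h0; pose F x := \int[mu]_(t in `[a - 1, x]) h t.
have F0 x : x <= a -> F x = 0.
  move=> xa; rewrite /F (@eq_Rintegral _ _ _ mu _ (cst 0)) ?Rintegral_cst ?mul0r //.
  move=> y; rewrite inE /= in_itv /= => /andP[_ yx].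
  by apply: h0; exact: le_trans yx xa.
exists F; split => // x; case: (ltP x a) => xa.
  rewrite h0 ?(ltW xa) //.
  apply: (near_eq_is_derive (f := cst 0)).
  near=> y; rewrite F0 ?ltW //; near: y; exact: lt_nbhsl.
have ax : a - 1 < x by lra.
have xx1 : x < x + 1 by rewrite ltrDl.
have [dF F'] := continuous_FTC1_closed xx1 (cts_integrable _ _ ch) ax (ch x).
by rewrite -F' derive1E; exact: derivableP.
Unshelve. all: by end_near. Qed.

Lemma primitive_from_right h b : continuous h -> (forall x, b <= x -> h x = 0) ->
  exists F, (forall x, is_derive x 1 F (h x)) /\ forall x, b <= x -> F x = 0.
Proof.
move=> ch h0.
have [||F [dF F0]] := @primitive_from_left (fun x => h (- x)) (- b).
- by move=> x; apply: continuous_comp; [exact: opp_continuous|exact: ch].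
- by move=> x xb; apply: h0; lra.
exists (fun x => -1 * F (-1 * x + 0)); split => [x|x bx]; last first.
  by rewrite F0 ?mulr0 //; lra.
have := is_derive_fun_scale (-1) (is_derive_comp_affine (dF (-1 * x + 0))).
by move=> hd; apply: (is_derive_eq hd); rewrite !mulN1r addr0 !opprK.
Qed.

Lemma eq_cst_right F a : continuous F -> (forall x, a < x -> is_derive x 1 F 0) ->
  forall x, a <= x -> F x = F a.
Proof.
move=> cF dF x ax.
have d y : y \in `]a, +oo[%R -> derivable F y 1.
  by rewrite in_itv /= andbT => /dF h; exact: (@ex_derive _ _ _ _ _ _ _ h).
have d0 y : y \in `]a, +oo[%R -> derive1 F y = 0.
  by rewrite in_itv /= andbT => /dF h; exact: derive1_val.
have cF' : {within `[a, +oo[, continuous F} by exact: continuous_subspaceT.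
apply/eqP; rewrite eq_le; apply/andP; split.
  by apply: (@ler0_derive1_nincry _ F a) => // y hy; rewrite d0.
by apply: (@ger0_derive1_ndecry _ F a) => // y hy; rewrite d0.
Qed.

Lemma Rintegral_derive f F a b : a < b -> continuous f -> continuous F ->
  (forall x, a < x < b -> is_derive x 1 F (f x)) ->
  \int[mu]_(x in `[a, b]) f x = F b - F a.
Proof.
move=> ab cf cF dF.
rewrite /Rintegral (@continuous_FTC2 _ f F a b ab) //.
- exact: continuous_subspaceT.
- split; first by move=> x; rewrite in_itv /= => /dF h;
    exact: (@ex_derive _ _ _ _ _ _ _ h).
  + exact: cvg_at_right_filter (cF a).
  + exact: cvg_at_left_filter (cF b).
- by move=> x; rewrite in_itv /= => /dF h; exact: derive1_val.
Qed.

End primitives.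

(** * The nonlocal operator through two primitives *)

Section helmholtz.
Context {R : realType}.
Local Notation mu := (@lebesgue_measure R).
Implicit Types (f g h F P Q : R -> R) (x a b c : R).

(** The kernel splits at y = x into e^(-x) e^y on the left and - e^x e^(-y) on the
right. The hypotheses on P and Q are one-sided in x so that, on a stretch
where g has a simple form on one side only, an explicit primitive valid on that
side can be used. *)
Lemma dx_inv_helmholtz_primitive g P Q (M x : R) :
  continuous g -> (forall y, M <= `|y| -> g y = 0) ->
  continuous P -> continuous Q ->
  (forall y, y < x -> is_derive y 1 P (expR y * g y)) ->
  (forall y, x < y -> is_derive y 1 Q (expR (- y) * g y)) ->
  (forall y, y <= - M -> P y = 0) -> (forall y, M <= y -> Q y = 0) ->
  dx_inv_helmholtz g x = - 2^-1 * (expR (- x) * P x + expR x * Q x).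
Proof.
move=> cg g0 cP cQ dP dQ P0 Q0; rewrite /dx_inv_helmholtz; congr (_ * _).
pose K : R := `|M| + `|x| + 1.
have [Kx xK MK] : [/\ - K < x, x < K & M <= K].
  have := ler_norm M; have := ler_norm x; have := ler_norm (- x).
  have := normr_ge0 M; have := normr_ge0 x; rewrite normrN.
  by move=> h1 h2 h3 h4 h5; split; rewrite /K; lra.
(* the value of the kernel at y = x is 0, hence the two open ends at x *)
pose f1 y := expR (y - x) * g y; pose f2 y := expR (x - y) * g y.
have ce (s c : R) : continuous (fun y => expR (s * y + c)).
  move=> y; apply: continuous_comp; last exact: continuous_expR.
  exact: (is_derive_cts (is_derive_affine s c)).
have cf1 : continuous f1.
  rewrite /f1 => y; apply: cvgM; last exact: cg.
  by have := ce 1 (- x) y; under eq_fun do rewrite mul1r.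
have cf2 : continuous f2.
  rewrite /f2 => y; apply: cvgM; last exact: cg.
  by have := ce (- 1) x y; under eq_fun do rewrite mulN1r addrC.
have kE y : Num.sg (x - y) * expR (- `|x - y|) * g y =
    (f1 \_ `[- K, x[) y - (f2 \_ `]x, K]) y.
  rewrite !patchE !mem_setE !in_itv /= /f1 /f2.
  case: (ltgtP y x) => [yx|xy|->]; rewrite ?andbF ?andbT /=.
  - rewrite gtr0_sg ?subr_gt0 // mul1r gtr0_norm ?subr_gt0 // opprB subr0.
    case: ifPn => //; rewrite -ltNge => yK; rewrite g0 ?mulr0 //.
    by rewrite ler_normr; apply/orP; right; lra.
  - rewrite ltr0_sg ?subr_lt0 // ltr0_norm ?subr_lt0 // opprK sub0r mulN1r mulNr.
    case: ifPn => //; rewrite -ltNge => yK; rewrite g0 ?mulr0 //.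
    by rewrite ler_normr; apply/orP; left; lra.
  - by rewrite subrr sgr0 !mul0r subr0.
under eq_Rintegral do rewrite kE.
have i1 : mu.-integrable `[- K, x[ (EFin \o f1).
  apply: integrableS (cts_integrable (-K) x cf1) => //.
  by apply: subset_itvl; rewrite bnd_simp.
have i2 : mu.-integrable `]x, K] (EFin \o f2).
  apply: integrableS (cts_integrable x K cf2) => //.
  by apply: subset_itvr; rewrite bnd_simp.
have j1 : mu.-integrable setT (EFin \o (f1 \_ `[- K, x[)).
  by rewrite -restrict_EFin; apply: (integrable_mkcond _ _).1 i1.
have j2 : mu.-integrable setT (EFin \o (f2 \_ `]x, K])).
  by rewrite -restrict_EFin; apply: (integrable_mkcond _ _).1 i2.
rewrite (RintegralB _ j1 j2) //.
rewrite -!Rintegral_mkcond Rintegral_itv_bndo_bndc // Rintegral_itv_obnd_cbnd //.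
have -> : \int[mu]_(y in `[- K, x]) f1 y = expR (- x) * P x - expR (- x) * P (- K).
  apply: (Rintegral_derive (F := fun y => expR (- x) * P y)) => //.
    by move=> y; apply: cvgM; [exact: cvg_cst|exact: cP].
  move=> y /andP[_ yx].
  have -> : f1 y = expR (- x) * (expR y * g y) by rewrite /f1 expRD; ring.
  exact: is_derive_fun_scale (dP _ yx).
have -> : \int[mu]_(y in `[x, K]) f2 y = expR x * Q K - expR x * Q x.
  apply: (Rintegral_derive (F := fun y => expR x * Q y)) => //.
    by move=> y; apply: cvgM; [exact: cvg_cst|exact: cQ].
  move=> y /andP[xy _].
  have -> : f2 y = expR x * (expR (- y) * g y) by rewrite /f2 expRD; ring.
  exact: is_derive_fun_scale (dQ _ xy).
rewrite (P0 (- K)) ?(Q0 K) //; last lra.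
by rewrite !mulr0 subr0 sub0r opprK.
Qed.

Lemma continuous_dx_inv_helmholtz g (M : R) :
  continuous g -> (forall y, M <= `|y| -> g y = 0) ->
  continuous (dx_inv_helmholtz g).
Proof.
move=> cg g0.
have ce (s : R) : continuous (fun y => expR (s * y)).
  move=> y; apply: continuous_comp; last exact: continuous_expR.
  exact: mulrl_continuous.
have cN : continuous (fun y : R => expR (- y)).
  by move=> y; have := ce (-1) y; under eq_fun do rewrite mulN1r.
have cm f : continuous f -> continuous (fun y => f y * g y).
  by move=> cf y; apply: cvgM; [exact: cf|exact: cg].
have [P [dP P0]] : exists P, (forall x, is_derive x 1 P (expR x * g x)) /\
    forall x, x <= - M -> P x = 0.
  apply: primitive_from_left; first exact/cm/continuous_expR.
  by move=> x hx; rewrite g0 ?mulr0 // ler_normr; apply/orP; right; lra.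
have [Q [dQ Q0]] : exists Q, (forall x, is_derive x 1 Q (expR (- x) * g x)) /\
    forall x, M <= x -> Q x = 0.
  apply: primitive_from_right; first exact/cm/cN.
  by move=> x hx; rewrite g0 ?mulr0 // ler_normr hx.
have [cP cQ] := (is_derive_cts dP, is_derive_cts dQ).
have -> : dx_inv_helmholtz g =
    fun x => - 2^-1 * (expR (- x) * P x + expR x * Q x).
  by apply/funext => x; exact: (@dx_inv_helmholtz_primitive g P Q M).
move=> x; apply: cvgM; first exact: cvg_cst.
apply: cvgD; apply: cvgM.
- exact: cN.
- exact: cP.
- exact: continuous_expR.
- exact: cQ.
Qed.

End helmholtz.

(** * A descent to zero with balanced weighted energy *)

Section profile.
Context {R : realType}.
Implicit Types (f g w : R -> R) (b c s x : R).

Definition energy b w x : R := b / 2 * w x ^+ 2 + (3 - b) / 2 * derive1 w x ^+ 2.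

Lemma energy_locally b f g x : (\near x, f x = g x) -> energy b f x = energy b g x.
Proof. by move=> fg; rewrite /energy (derive1_locally fg) (nbhs_singleton fg). Qed.

Lemma energy_cst b c x : energy b (cst c) x = b / 2 * c ^+ 2.
Proof. by rewrite /energy derive1_cst expr0n /= mulr0 addr0. Qed.

Lemma energy_scale b c w x : derivable w x 1 ->
  energy b (fun y => c * w y) x = c ^+ 2 * energy b w x.
Proof.
move=> dw; rewrite /energy.
rewrite (derive1_val (is_derive_fun_scale c (is_derive_derive1 dw))); ring.
Qed.

(** Translations and reflections are the affine maps with a = 1 and a = -1. *)
Lemma energy_comp_affine b w (a c x : R) : a ^+ 2 = 1 ->
  derivable w (a * x + c) 1 ->
  energy b (fun y => w (a * y + c)) x = energy b w (a * x + c).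
Proof.
move=> a1 dw; rewrite /energy.
rewrite (derive1_val (is_derive_comp_affine (is_derive_derive1 dw))).
by rewrite exprMn a1 mul1r.
Qed.

Lemma energy_continuous b w : smooth w -> continuous (energy b w).
Proof.
move=> sw; have cw := derivable_cts (smooth_derivable sw).
have cw' := derivable_cts (smooth_derivable (smooth_derive1 sw)).
move=> x; rewrite /energy; apply: cvgD; apply: cvgM; try exact: cvg_cst.
  by rewrite expr2; under eq_fun do rewrite expr2; apply: cvgM; exact: cw.
by rewrite expr2; under eq_fun do rewrite expr2; apply: cvgM; exact: cw'.
Qed.

Lemma expR_energy_primitive b w a : smooth w ->
  (forall x, x <= a -> energy b w x = 0) ->
  exists p, (forall x, is_derive x 1 p (expR x * energy b w x)) /\
    forall x, x <= a -> p x = 0.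
Proof.
move=> sw w0; apply: primitive_from_left.
  move=> x; apply: cvgM; first exact: continuous_expR.
  exact: energy_continuous.
by move=> x xa; rewrite w0 ?mulr0.
Qed.

(** The conjugate form - 2 A / (B + sqrt (B^2 - 4 A C)) of the root stays
meaningful when C = 0. *)
Lemma quadratic_root (A B C : R) : 0 < B -> 4 * A * C <= B ^+ 2 ->
  exists s, A + B * s + C * s ^+ 2 = 0.
Proof.
move=> B0 hd; pose d := Num.sqrt (B ^+ 2 - 4 * A * C).
have d2 : d ^+ 2 = B ^+ 2 - 4 * A * C by rewrite sqr_sqrtr // subr_ge0.
have Bd : B + d != 0 by rewrite gt_eqF // ltr_pwDl // sqrtr_ge0.
exists (- 2 * A / (B + d)).
have -> : A + B * (- 2 * A / (B + d)) + C * (- 2 * A / (B + d)) ^+ 2 =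
  A * (d ^+ 2 - (B ^+ 2 - 4 * A * C)) / (B + d) ^+ 2 by field.
by rewrite d2 subrr mulr0 mul0r.
Qed.

Lemma expRN_small (k e : R) : 0 < e -> exists2 L, 2 <= L & k * expR (- L) <= e.
Proof.
move=> e0; exists (2 + `|k| / e); first by rewrite lerDl divr_ge0 // ltW.
rewrite expRN ler_pdivrMr ?expR_gt0 //.
apply: (@le_trans _ _ (e * (1 + (2 + `|k| / e)))).
  have -> : e * (1 + (2 + `|k| / e)) = 3 * e + `|k| by field; rewrite gt_eqF.
  have := ler_norm k; lra.
by rewrite ler_pM2l // expR_ge1Dx.
Qed.

(** The primitive p of e^x (energy of w) that starts at 0 on the far left agrees,
on the right half-line, with the one of the constant 1: the descent of w from 1
to 0 has the weighted energy of a constant. *)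
Lemma balanced_left_profile b : 0 < b -> exists (w p : R -> R) (N : R),
  [/\ 0 <= N, smooth w, forall x, is_derive x 1 p (expR x * energy b w x),
      forall x, x <= - N -> w x = 0 /\ p x = 0 &
      forall x, 0 <= x -> w x = 1 /\ p x = b / 2 * expR x].
Proof.
move=> b0; have [chi [schi chi0 chi1]] := @smooth_step R.
have dchi := smooth_derivable schi.
have chi'0 x : x < -1 -> derive1 chi x = 0.
  move=> hx; apply: (derive1_locally_cst (c := 0)).
  near=> y; apply: chi0; apply: ltW; near: y; exact: lt_nbhsl.
have chi'1 x : - 2^-1 < x -> derive1 chi x = 0.
  move=> hx; apply: (derive1_locally_cst (c := 1)).
  near=> y; apply: chi1; apply: ltW; near: y; exact: lt_nbhsr.
(* the factor e^(-x) makes chi itself the primitive of e^x phi, so that the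
   linear coefficient of the defect is b *)
pose phi x := expR (-1 * x + 0) * derive1 chi x.
have sphi : smooth phi.
  move=> n; apply: CnM; last exact: smooth_derive1.
  by apply: Cn_comp_affine; exact: smooth_expR.
have dphi := smooth_derivable sphi.
have phi0 x : x < -1 \/ - 2^-1 < x -> phi x = 0.
  by case=> [/chi'0|/chi'1]; rewrite /phi => ->; rewrite mulr0.
have phi'0 x : x < -1 \/ - 2^-1 < x -> derive1 phi x = 0.
  case=> hx; apply: (derive1_locally_cst (c := 0)); near=> y; apply: phi0.
    by left; near: y; exact: lt_nbhsl.
  by right; near: y; exact: lt_nbhsr.
have [pc [dpc pc0]] : exists p,
    (forall x, is_derive x 1 p (expR x * energy b chi x)) /\
    forall x, x <= -2 -> p x = 0.
  apply: expR_energy_primitive => // x hx.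
  by rewrite /energy chi0 ?chi'0 //; [ring|lra|lra].
have [pf [dpf pf0]] : exists p,
    (forall x, is_derive x 1 p (expR x * energy b phi x)) /\
    forall x, x <= -2 -> p x = 0.
  apply: expR_energy_primitive => // x hx.
  by rewrite /energy phi0 ?phi'0; [ring|left; lra|left; lra].
have [k pcE] : exists k, forall x, 0 <= x -> pc x = b / 2 * expR x + k.
  have dd x : is_derive x 1 (fun y => pc y + (- (b / 2)) * expR y)
      (expR x * energy b chi x + (- (b / 2)) * expR x).
    exact: is_derive_fun_add (dpc x) (is_derive_fun_scale _ (is_derive_expR x)).
  exists (pc 0 + - (b / 2) * expR 0) => x x0.
  have dd0 (y : R) : 0 < y -> is_derive y 1 (fun y => pc y + (- (b / 2)) * expR y) 0.
    move=> y0; apply: (is_derive_eq (dd y)).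
    by rewrite /energy chi1 ?chi'1; [ring|lra|lra].
  have := eq_cst_right (is_derive_cts dd) dd0 x0; lra.
have pfE x : 0 <= x -> pf x = pf 0.
  apply: eq_cst_right; first exact: (is_derive_cts dpf).
  move=> y y0; apply: (is_derive_eq (dpf y)).
  by rewrite /energy phi0 ?phi'0; [ring|right; lra|right; lra].
(* k e^(-L) is the cost of the cut-off at distance L; the bound says that the
   discriminant of the defect is nonnegative *)
have [L L2 hL] := @expRN_small (4 * k * pf 0) (b ^+ 2) (exprn_gt0 2 b0).
have [s hs] : exists s, k * expR (- L) + b * s + pf 0 * s ^+ 2 = 0.
  apply: quadratic_root => //; apply: le_trans hL.
  by rewrite [leLHS](_ : _ = 4 * k * pf 0 * expR (- L)) //; ring.
pose chiL x := chi (1 * x + L).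
have schiL : smooth chiL by move=> n; exact: Cn_comp_affine.
have dchiL := smooth_derivable schiL.
exists (fun x => chiL x + s * phi x).
exists (fun x => expR (- L) * pc (1 * x + L) + (b * s * chi x + s ^+ 2 * pf x)).
exists (L + 2); split.
- lra.
- by move=> n; apply: CnD => //; apply: CnM => //; exact: Cn_cst.
- move=> x.
  have d1 := is_derive_fun_scale (expR (- L))
    (is_derive_comp_affine (dpc (1 * x + L))).
  have d2 := is_derive_fun_scale (b * s) (is_derive_derive1 (dchi x)).
  have d3 := is_derive_fun_scale (s ^+ 2) (dpf x).
  apply: (is_derive_eq (is_derive_fun_add d1 (is_derive_fun_add d2 d3))).
  have dw := is_derive_fun_add (is_derive_derive1 (dchiL x))
    (is_derive_fun_scale s (is_derive_derive1 (dphi x))).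
  have eL : expR (1 * x + L) = expR x * expR L by rewrite mul1r expRD.
  have eN : expR (- L) * expR L = 1 by rewrite -expRD addNr expR0.
  have ex : expR x * phi x = derive1 chi x.
    by rewrite /phi mulrA -expRD mulN1r addr0 addrN expR0 mul1r.
  (* the bump lives where the cut-off is constantly 1, as L >= 2 *)
  have cross : chiL x * phi x = phi x /\ derive1 chiL x * derive1 phi x = 0.
    case: (ltP x (-1)) => hx.
      by rewrite phi0 ?phi'0 ?mulr0 //; left.
    rewrite /chiL chi1 ?mul1r; last lra.
    rewrite (derive1_val (is_derive_comp_affine (is_derive_derive1 (dchi _)))).
    by rewrite chi'1 ?mulr0 ?mul0r //; lra.
  have -> : energy b chi (1 * x + L) = energy b chiL x.
    by rewrite energy_comp_affine // expr1n.
  rewrite [in RHS]/energy (derive1_val dw) eL -ex.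
  have [c1 c2] := cross.
  have -> : b / 2 * (chiL x + s * phi x) ^+ 2 +
      (3 - b) / 2 * (derive1 chiL x + s * derive1 phi x) ^+ 2 =
      energy b chiL x + s ^+ 2 * energy b phi x + b * s * (chiL x * phi x) +
      (3 - b) * s * (derive1 chiL x * derive1 phi x).
    by rewrite /energy; field.
  by rewrite c1 c2; ring: eN.
- move=> x hx; rewrite /chiL chi0; last lra.
  rewrite phi0; last by left; lra.
  by rewrite pc0 ?chi0 ?pf0; [split; ring|lra|lra|lra].
- move=> x hx; rewrite /chiL chi1; last lra.
  rewrite phi0; last by right; lra.
  rewrite mulr0 addr0; split => //.
  rewrite pcE; last lra.
  rewrite pfE // chi1; last lra.
  rewrite mul1r expRD.
  have eN : expR (- L) * expR L = 1 by rewrite -expRD addNr expR0.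
  have -> : expR (- L) * (b / 2 * (expR x * expR L) + k) +
      (b * s * 1 + s ^+ 2 * pf 0) =
      b / 2 * expR x * (expR (- L) * expR L) +
      (k * expR (- L) + b * s + pf 0 * s ^+ 2) by ring.
  by rewrite eN hs mulr1 addr0.
Unshelve. all: by end_near. Qed.

End profile.

(** * The initial datum and its solutions *)

Section datum.
Context {R : realType}.
Local Notation mu := (@lebesgue_measure R).
Implicit Types (f g w u : R -> R) (b c a x : R).

Lemma L2_cst_eq0 c : L2 (cst c) -> c = 0.
Proof.
move=> /(Lfun_integrable (ler1n R 2 : 1 <= 2)) /integrableP[_].
rewrite (eq_integral (cst (`|c| `^ 2)%:E)); last first.
  by move=> x _ /=; rewrite ger0_norm // powR_ge0.
have muT : mu setT = +oo%E by rewrite -set_itvNyy lebesgue_measure_itv.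
rewrite integral_cst // [X in (_ * X)%E]muT.
have [//|c0] := eqVneq c 0.
by rewrite gt0_muley ?ltxx // lte_fin powR_gt0 // normr_gt0.
Qed.

Lemma energy_eq0_outside b w (M : R) : (forall x, M <= `|x| -> w x = 0) ->
  forall x, M + 1 <= `|x| -> energy b w x = 0.
Proof.
move=> w0 x Mx; rewrite (@energy_locally _ b w (cst 0)).
  by rewrite energy_cst expr0n mulr0.
near=> y; apply: w0; apply: ltW; near: y.
by apply: (cvgr_gt `|x| (@norm_continuous _ _ x)); lra.
Unshelve. all: by end_near. Qed.

Lemma Cinfty0_smooth f (M : R) :
  smooth f -> (forall x, M <= `|x| -> f x = 0) -> Cinfty0 f.
Proof.
move=> sf f0; split; first exact: smooth_derive1n.
apply: (@subclosed_compact _ _ `[- M, M]).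
- exact: closed_closure.
- exact: segment_compact.
- have cM : closed (`[- M, M] : set R) by exact: interval_closed.
  rewrite ((closure_id _).1 cM).
  apply: closure_subset => x /= /eqP fx; rewrite in_itv /=.
  rewrite -ler_norml leNgt; apply/negP => hx; apply: fx; apply: f0; exact: ltW.
Qed.

(** Left of any x between alpha and beta the datum is c times a translate of the
balanced profile, and right of x it is c times a mirror image of it. So the two
primitives in the formula for the nonlocal operator are read off that of the
profile, and their values at x are those for the constant c, which cancel. *)
Lemma stationary_datum b c alpha beta : 0 < b -> alpha < beta ->
  exists (u : R -> R) (M : R),
  [/\ smooth u, forall x, M <= `|x| -> u x = 0,
      forall x, alpha <= x <= beta -> u x = c,
      forall x, alpha <= x <= beta -> derive1 u x = 0 &
      forall x, alpha <= x <= beta -> dx_inv_helmholtz (energy b u) x = 0].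
Proof.
move=> b0 ab.
have [w [p [N [N0 sw dp wl wr]]]] := balanced_left_profile b0.
have dw := smooth_derivable sw.
(* one unit of room on both sides makes the datum locally constant on the whole
   closed interval *)
pose a' := alpha - 1; pose b' := beta + 1.
pose wl' x := w (1 * x + - a'); pose wr' x := w (-1 * x + b').
have swl : smooth wl' by move=> n; exact: Cn_comp_affine.
have swr : smooth wr' by move=> n; exact: Cn_comp_affine.
have wl1 x : a' <= x -> wl' x = 1.
  by move=> hx; rewrite /wl' (wr _ _).1 //; lra.
have wr1 x : x <= b' -> wr' x = 1.
  by move=> hx; rewrite /wr' (wr _ _).1 //; lra.
pose u x := c * (wl' x * wr' x).
have su : smooth u.
  by move=> n; apply: CnM; [exact: Cn_cst|apply: CnM].
have eL x : x < b' -> energy b u x = c ^+ 2 * energy b w (1 * x + - a').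
  move=> hx; rewrite -(energy_comp_affine b (expr1n _ 2)) //.
  rewrite -energy_scale; last exact: smooth_derivable.
  apply: energy_locally; near=> y; rewrite /u wr1 ?mulr1 //.
  by apply: ltW; near: y; exact: lt_nbhsl.
have eR x : a' < x -> energy b u x = c ^+ 2 * energy b w (-1 * x + b').
  move=> hx; rewrite -(energy_comp_affine b _ (dw _)) ?sqrrN ?expr1n //.
  rewrite -energy_scale; last exact: smooth_derivable.
  apply: energy_locally; near=> y; rewrite /u wl1 ?mul1r //.
  by apply: ltW; near: y; exact: lt_nbhsr.
have uc x : a' < x < b' -> u x = c.
  by move=> /andP[h1 h2]; rewrite /u wl1 ?wr1 ?mulr1 ?ltW.
pose M : R := N + `|a'| + `|b'| + 1.
have uM x : M <= `|x| -> u x = 0.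
  rewrite /M ler_normr => /orP hx.
  have hb := ler_norm b'; have ha := ler_norm (- a'); rewrite normrN in ha.
  have [na nb] := (normr_ge0 a', normr_ge0 b').
  rewrite /u; case: hx => hx.
    by rewrite /wr' (wl _ _).1 ?mulr0 //; lra.
  by rewrite /wl' (wl _ _).1 ?mul0r ?mulr0 //; lra.
have gM := energy_eq0_outside b uM.
have cg := energy_continuous (b := b) su.
exists u, M; split => // x /andP[hax hxb].
- by rewrite uc // /a' /b'; apply/andP; split; lra.
- apply: (derive1_locally_cst (c := c)); near=> y; apply: uc.
  apply/andP; split; near: y; [apply: lt_nbhsr|apply: lt_nbhsl]; rewrite /a' /b'; lra.
have [ax xb] : a' < x /\ x < b' by rewrite /a' /b'; split; lra.
have cp : continuous p := is_derive_cts dp.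
have cpa (s d k : R) : continuous (fun y => k * p (s * y + d)).
  move=> y; apply: cvgM; first exact: cvg_cst.
  apply: continuous_comp; last exact: cp.
  exact: (is_derive_cts (is_derive_affine s d)).
pose P y := c ^+ 2 * expR a' * p (1 * y + - a').
pose Q y := - (c ^+ 2 * expR (- b')) * p (-1 * y + b').
have -> : dx_inv_helmholtz (energy b u) x =
    - 2^-1 * (expR (- x) * P x + expR x * Q x).
  apply: (dx_inv_helmholtz_primitive cg gM); try exact: cpa.
  - move=> y yx; rewrite eL; last exact: lt_trans xb.
    have := is_derive_fun_scale (c ^+ 2 * expR a')
      (is_derive_comp_affine (dp (1 * y + - a'))).
    move=> h; apply: (is_derive_eq h); rewrite (mul1r y) (expRD y).
    by have e2 := expRxMexpNx_1 a'; ring: e2.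
  - move=> y yx; rewrite eR; last exact: lt_trans yx.
    have := is_derive_fun_scale (- (c ^+ 2 * expR (- b')))
      (is_derive_comp_affine (dp (-1 * y + b'))).
    move=> h; apply: (is_derive_eq h); rewrite (mulN1r y) (expRD (- y)).
    by have e2 := expRxMexpNx_1 b'; ring: e2.
  - move=> y hy; rewrite /P (wl _ _).2 ?mulr0 //.
    have ha := ler_norm (- a'); rewrite normrN in ha.
    by have [na nb] := (normr_ge0 a', normr_ge0 b'); rewrite /M in hy; lra.
  - move=> y hy; rewrite /Q (wl _ _).2 ?mulr0 //.
    have hb := ler_norm b'.
    by have [na nb] := (normr_ge0 a', normr_ge0 b'); rewrite /M in hy; lra.
rewrite /P /Q (wr _ _).2; last lra.
rewrite (wr (-1 * x + b') _).2; last lra.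
rewrite (mul1r x) (mulN1r x) (expRD x) (expRD (- x)).
have e1 := expRxMexpNx_1 x; have e2 := expRxMexpNx_1 a'.
have e3 := expRxMexpNx_1 b'.
by ring: e1 e2 e3.
Unshelve. all: by end_near. Qed.

Lemma corresponding_solution_L2 b u0 (T : R) (u ut : R -> R -> R) :
  corresponding_solution b u0 T u ut ->
  solves_ivp b u0 T u ut /\ forall t, - T < t < T -> L2 (u t).
Proof.
have HsL2 s f : Hs s f -> L2 f by case=> ? [? [[]]].
have itv t : - T < t < T -> `[- T, T]%classic t.
  by move=> /andP[? ?]; rewrite /= in_itv /= !ltW.
move=> [[hC _ _ hs]|[s [_ [hC _ hs]]]]; split => // t /itv /hC[+ _]; exact: HsL2.
Qed.

End datum.

Unset Implicit Arguments.
Set Strict Implicit.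
Set Printing Implicit Defensive.

Theorem theorem1p4 (R : realType) (b c0 alpha beta : R)
    (hb0 : 0 < b) (hb3 : b <= 3) (hc0 : c0 != 0) (hab : alpha < beta) :
  exists u0 : R -> R,
    [/\ Cinfty0 u0,
        (forall x : R, alpha <= x <= beta -> u0 x = c0) &
        forall (T : R) (u ut : R -> R -> R),
          0 < T -> corresponding_solution b u0 T u ut ->
          (* v is the continuous representative of d_t u(.,0) *)
          (exists v : R -> R,
            [/\ continuous v,
                {ae lebesgue_measure, forall x : R, v x = ut 0 x} &
                forall x : R, alpha <= x <= beta -> v x = 0]) /\
          (forall t : R, - T < t < T -> ~ (forall x : R, u t x = c0))].
Proof.
have [u0 [M [su u0M u0c u0' hz]]] := stationary_datum c0 hb0 hab.
have cg := energy_continuous (b := b) su.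
have gM := energy_eq0_outside b u0M.
exists u0; split => //; first exact: Cinfty0_smooth su u0M.
move=> T u ut T0 /corresponding_solution_L2[[_ ui hE] uL2]; split.
  exists (fun x => - (u0 x * derive1 u0 x + dx_inv_helmholtz (energy b u0) x)).
  split.
  - move=> x; apply: cvgN; apply: cvgD; last first.
      exact: (continuous_dx_inv_helmholtz cg gM).
    apply: cvgM; first exact: (derivable_cts (smooth_derivable su)).
    exact: (derivable_cts (smooth_derivable (smooth_derive1 su))).
  - have t0 : (0 : R) \in `]- T, T[ by rewrite in_itv /= oppr_lt0 T0.
    have := hE 0 t0; rewrite ui; apply: negligibleS => x /=; apply: contra_not => hx.
    by apply/esym/eqP; rewrite -addr_eq0 addrA hx.
  - by move=> x hx; rewrite u0' // hz // mulr0 addr0 oppr0.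
move=> t /uL2 hL2 hc; move/eqP: hc0; apply.
by apply: (@L2_cst_eq0 R); rewrite -(_ : u t = cst c0) //; apply/funext.
Qed.
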